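(* Let $\Sigma$ be a set of equations. If $\rho$ and $d$ are metrics defining one and the same topology on a set $A$, if that topology is compact, and if $\lambda_{(A,\rho)}(\Sigma)>0$, then $\lambda_{(A,d)}(\Sigma)>0$.
   Context: Terms are built from variables and operation symbols $F_t$ ($t\in T$) of finite arities $n_t\ge0$; an equation $\sigma\approx\tau$ is an ordered pair of terms. An algebra $\mathbf A=(A;\overline F_t)_{t\in T}$ has operations $\overline F_t:A^{n_t}\to A$; each term $\sigma$ yields a term operation $\sigma^{\mathbf A}:A^\omega\to A$. For a nonempty metric space $(A,d)$ put $\lambda_{(\mathbf A,d)}(\Sigma)=\sup\{d(\sigma^{\mathbf A}(\mathbf a),\tau^{\mathbf A}(\mathbf a)):\sigma\approx\tau\in\Sigma,\ \mathbf a\in A^\omega\}$ (sup of the empty set is $0$), and $\lambda_{(A,d)}(\Sigma)=\inf\lambda_{(\mathbf A,d)}(\Sigma)$ over all algebras $\mathbf A$ on $A$ (of the type of $\Sigma$) whose operations are continuous. *)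

(* Defs.v *)
From HB Require Import structures.
From mathcomp Require Import all_boot all_order all_algebra.
From mathcomp Require Import all_classical all_reals all_analysis.

Set Implicit Arguments.
Unset Strict Implicit.
Unset Printing Implicit Defensive.

Import Order.TTheory GRing.Theory Num.Theory.
Import numFieldNormedType.Exports.

Local Open Scope classical_set_scope.
Local Open Scope ring_scope.

Section Terms.
Context {T : Type} (ar : T -> nat).

Inductive term : Type :=
| Var (i : nat)
| App (t : T) (args : 'I_(ar t) -> term).

Definition equation : Type := (term * term)%type.

Definition operations (A : Type) : Type := forall t : T, ('I_(ar t) -> A) -> A.

Fixpoint eval (A : Type) (F : operations A) (s : term) (a : nat -> A) : A :=
  match s with
  | Var i => a i
  | App t args => F t (fun i => eval F (args i) a)
  end.

End Terms.

Section Metric.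
Context {R : realType} {A : Type}.

Record is_metric (d : A -> A -> R) : Prop := IsMetric {
  is_metric_eq0 : forall x y, d x y = 0 <-> x = y ;
  is_metric_sym : forall x y, d x y = d y x ;
  is_metric_triangle : forall y x z, d x z <= d x y + d y z
}.

(* An alias of A, so that several metrics on A can coexist, each with its own
   topology. The eqType and choiceType structures are the classical ones. *)
Definition metric_space (d : A -> A -> R) (hd : is_metric d) : Type := A.

Context (d : A -> A -> R) (hd : is_metric d).

HB.instance Definition _ := gen_eqMixin (metric_space hd).
HB.instance Definition _ := gen_choiceMixin (metric_space hd).
HB.instance Definition _ := @isMetric.Build R (metric_space hd) d
  (fun x => (is_metric_eq0 hd x x).2 erefl)
  (fun x y => (is_metric_eq0 hd x y).1)
  (is_metric_sym hd) (is_metric_triangle hd).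

End Metric.

Section Lambda.
Context {R : realType} {T : Type} {ar : T -> nat}.
Local Open Scope ereal_scope.

(* Distances are nonnegative, so adjoining 0 only affects the supremum of the
   empty set, which becomes 0 instead of -oo. *)
Definition lambda_alg (M : metricType R) (F : operations ar M)
    (Sigma : set (equation ar)) : \bar R :=
  ereal_sup (0 |` [set r | exists e : equation ar, exists a : nat -> M,
    Sigma e /\ r = (mdist (eval F e.1 a) (eval F e.2 a))%:E]).

Definition continuous_operations (M : metricType R) (F : operations ar M) :=
  forall t : T, continuous (F t : prod_topology (fun _ : 'I_(ar t) => M) -> M).

Definition lambda (M : metricType R) (Sigma : set (equation ar)) : \bar R :=
  ereal_inf [set lambda_alg F Sigma | F in @continuous_operations M].

End Lambda.

(* Main.v *)
(* Transporting a continuous algebra along a homeomorphism preserves its term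
   operations, and by compactness the homeomorphism is uniformly continuous, so
   algebras nearly satisfying Sigma for one metric would be transported to
   algebras nearly satisfying it for the other. *)
Require Import Defs.
From mathcomp Require Import all_boot all_order all_algebra.
From mathcomp Require Import all_classical all_reals all_analysis.

Import Order.TTheory GRing.Theory Num.Theory.
Import numFieldNormedType.Exports.

Local Open Scope classical_set_scope.
Local Open Scope ring_scope.

(** Heine-Cantor through near-coverings: a radius that works locally around each point works, by
    compactness, for all points at once as it tends to 0 from the right. *)
Lemma compact_unif_continuous (R : realType) (U V : pseudoMetricType R)
    (f : U -> V) :
  compact [set: U] -> continuous f -> unif_continuous f.
Proof.
move=> /compact_near_coveringP cU cf; apply/unif_continuousP => e e0.
have /= : \forall r \near (0 : R)^'+, [set: U] `<=`
    (fun x => forall y, ball x r y -> ball (f x) e (f y)).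
  apply: cU => x _.
  have : \forall y \near x, ball (f x) (e / 2) (f y).
    by apply: cf; apply: nbhsx_ballx; rewrite divr_gt0.
  move=> /nbhs_ballP[r /= r0 xr].
  exists (ball x (r / 2), [set s | s < r / 2]) => /=.
    split; first by apply: nbhsx_ballx; rewrite divr_gt0.
    by apply: nbhs_right_lt; rewrite divr_gt0.
  (* With [x'] within [r / 2] of [x] and [s < r / 2], both [x'] and [y] lie in the [r]-ball at [x],
     so [f x'] and [f y] are each within [e / 2] of [f x]. *)
  move=> [x' s] /= [xx' sr] y x'y.
  apply: (@ball_splitr _ _ (f x)).
    by apply: xr; apply: le_ball xx'; rewrite ler_pdivrMr// ler_peMr ?ltW// ltr1n.
  by apply/xr/(ball_split xx')/(le_ball (ltW sr)).
move=> near_r.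
have [r [r0 rP]] : exists r : R, 0 < r /\ [set: U] `<=`
    (fun x => forall y, ball x r y -> ball (f x) e (f y)).
  near (0 : R)^'+ => r; exists r; split; first by near: r; exact: nbhs_right_gt.
  by near: r.
by exists r => // xy; exact: rP.
Unshelve. all: by end_near.
Qed.

Lemma prod_topology_map_continuous (I : eqType) (X Y : topologicalType)
    (f : X -> Y) :
  continuous f ->
  continuous ((fun x i => f (x i)) :
    prod_topology (fun _ : I => X) -> prod_topology (fun _ : I => Y)).
Proof.
(* The product topology is a supremum of initial topologies, so each coordinate is checked alone;
   the [i]-th one is [f] after a projection. *)
move=> cf x; apply/cvg_sup; first exact/fmap_filter/nbhs_filter.
move=> i W [_ [[C oC <-] Cx]] /filterS; apply.
  exact/fmap_filter/nbhs_filter.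
have := @continuous_comp (prod_topology (fun=> X)) _ _ (@proj I (fun=> X) i) f x
  (@proj_continuous I (fun=> X) i x) (cf (x i)).
by move=> /(_ C (open_nbhs_nbhs (conj oC Cx))).
Qed.

Definition transport {T : Type} {ar : T -> nat} {A B : Type} (f : A -> B)
    (g : B -> A) (F : operations ar B) : operations ar A :=
  fun t x => g (F t (fun i => f (x i))).

(** At each inner node the [g] of a subterm cancels against the [f] of the operation above it,
    leaving only the outermost [g]; at a variable, [g] undoes [f]. *)
Lemma eval_transport {T : Type} {ar : T -> nat} {A B : Type} (f : A -> B)
    (g : B -> A) (F : operations ar B) (s : term ar) (a : nat -> A) :
  cancel f g -> cancel g f ->
  Defs.eval (transport f g F) s a = g (Defs.eval F s (f \o a)).
Proof.
move=> fK gK; elim: s => [i|t args IH] /=; first by rewrite fK.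
by congr (g (F t _)); apply/funext => i; rewrite IH gK.
Qed.

Lemma transport_continuous {R : realType} {T : Type} {ar : T -> nat}
    {M N : metricType R} (f : M -> N) (g : N -> M) (F : operations ar N) :
  continuous f -> continuous g -> continuous_operations F ->
  continuous_operations (transport f g F).
Proof.
move=> cf cg cF t x.
pose Ff : prod_topology (fun _ : 'I_(ar t) => M) -> N :=
  fun y => F t (fun i => f (y i)).
have cFf : {for x, continuous Ff}.
  have cfx := @prod_topology_map_continuous 'I_(ar t) _ _ f cf x.
  exact: (continuous_comp cfx (cF t _)).
exact: (continuous_comp cFf (cg _)).
Qed.

Lemma lambda_gt0_homeo (R : realType) (T : Type) (ar : T -> nat)
    (Sigma : set (equation ar)) (M N : metricType R) (f : M -> N) (g : N -> M) :
  cancel f g -> cancel g f -> continuous f -> continuous g ->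
  compact [set: N] ->
  (0 < lambda M Sigma)%E -> (0 < lambda N Sigma)%E.
Proof.
move=> fK gK cf cg cN lM0.
(* A strict inequality is needed, since transport will only give a bound [<= e]. The value [+oo] is
   treated separately, with [e = 1]. *)
have [e e0 eM] : exists2 e : R, 0 < e & (e%:E < lambda M Sigma)%E.
  case: (lambda M Sigma) lM0 => [r| |] //; last by exists 1; rewrite ?ltry.
  by rewrite lte_fin => r0; exists (r / 2); rewrite ?lte_fin ?divr_gt0// gtr_pMr ?invf_lt1 ?ltr1n.
have /unif_continuousP/(_ e e0)[r r0 gr] :=
  compact_unif_continuous _ _ _ _ cN cg.
(* The modulus [r] of [g] at [e] bounds [lambda N Sigma] from below: an algebra on [N] with value
   below [r] would transport to one on [M] with value at most [e]. *)
apply: (@lt_le_trans _ _ r%:E); first by rewrite lte_fin.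
apply: le_ereal_inf_tmp => _ [F cF <-]; rewrite leNgt; apply/negP => Fr.
move: eM; apply/negP; rewrite -leNgt.
apply: ge_ereal_inf; exists (lambda_alg (transport f g F) Sigma).
  by exists (transport f g F) => //; exact: transport_continuous.
apply: ge_ereal_sup => _ [->|[s [a [Ss ->]]]]; first by rewrite lee_fin ltW.
rewrite lee_fin !eval_transport//.
have /(gr (_, _)) : ball (Defs.eval F s.1 (f \o a)) r (Defs.eval F s.2 (f \o a)).
  rewrite ballEmdist /= -lte_fin; apply: le_lt_trans Fr.
  by apply: ereal_sup_ubound; right; exists s, (f \o a).
by rewrite ballEmdist /= => /ltW.
Qed.

Theorem lemma2 (R : realType) (T : Type) (ar : T -> nat)
    (Sigma : set (equation ar)) (A : Type) (A_nonempty : [set: A] !=set0)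
    (rho d : A -> A -> R) (hrho : is_metric rho) (hd : is_metric d)
    (same_topology : forall U : set A,
      @open (metric_space hrho) U <-> @open (metric_space hd) U)
    (compact_topology : compact [set: metric_space hrho]) :
  (0 < lambda (metric_space hrho) Sigma)%E ->
  (0 < lambda (metric_space hd) Sigma)%E.
Proof.
(* The homeomorphism is the identity of [A], read between the two aliases. *)
pose f : metric_space hrho -> metric_space hd := fun x => x.
pose g : metric_space hd -> metric_space hrho := fun x => x.
have cf : continuous f by apply/continuousP => U /same_topology.
have cg : continuous g by apply/continuousP => U /same_topology.
apply: (@lambda_gt0_homeo _ _ _ _ _ _ f g) => //.
(* Compactness is given for [rho] and passes to [d] as a continuous image. *)
have -> : [set: metric_space hd] = f @` setT.
  by apply/seteqP; split => x // _; exists x.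
by apply: continuous_compact => //; exact: continuous_subspaceT.
Qed.
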